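(* Let $n\ge p$. For every $\mathcal X\in\mathrm{St}(n,p,l)$ and $\mathcal V\in T_{\mathcal X}\mathrm{St}(n,p,l)$ the tensor $\mathcal X+\mathcal V$ lies in $L^{-1}(\mathbb C^{n\times p\times l}_* )$, so $qf(\mathcal X+\mathcal V)$ is well defined, and the map $$R_{\mathcal X}(\mathcal V)=qf(\mathcal X+\mathcal V)$$ is a retraction on $\mathrm{St}(n,p,l)$.
   Context: Frontal slices $A^{(i)}=\mathcal A(:,:,i)$. The t-product is $\mathcal A*\mathcal B=\operatorname{fold}(\operatorname{bcirc}(\mathcal A)\operatorname{unfold}(\mathcal B))$, where $\operatorname{bcirc}(\mathcal A)$ is the block circulant matrix with $(i,j)$ block $A^{(((i-j)\bmod l)+1)}$, $\operatorname{unfold}$ stacks frontal slices vertically, $\operatorname{fold}$ is its inverse. Transpose: $\mathcal A^\top$ has frontal slices $(A^{(1)})^\top,(A^{(l)})^\top,\dots,(A^{(2)})^\top$. $\mathcal I$ is the identity tensor (first frontal slice identity, others zero). $\mathrm{St}(n,p,l)=\{\mathcal X\in\mathbb R^{n\times p\times l}:\mathcal X^\top*\mathcal X=\mathcal I\}$, an embedded submanifold of $\mathbb R^{n\times p\times l}$ with tangent spaces $T_{\mathcal X}\mathrm{St}(n,p,l)$. The DFT $L(\mathcal A)=\hat{\mathcal A}$ has frontal slices $\hat A^{(k)}=\sum_{j=1}^l\omega^{(k-1)(j-1)}A^{(j)}$, $\omega=e^{-2\pi\mathrm i/l}$; $L^{-1}$ is its inverse; $\mathcal C=\mathcal A*\mathcal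 B$ iff $\hat C^{(k)}=\hat A^{(k)}\hat B^{(k)}$ for all $k$. $\mathbb C^{n\times p\times l}_*$ is the set of complex tensors all of whose frontal slices have full column rank $p$; $\mathbb C^{p\times p\times l}_{upp+}$ is the set of complex tensors whose frontal slices are upper triangular with real, strictly positive diagonal. Every $\mathcal A\in L^{-1}(\mathbb C^{n\times p\times l}_* )$ has a unique t-QR decomposition $\mathcal A=\mathcal Q*\mathcal R$ with $\mathcal Q\in\mathrm{St}(n,p,l)$ and $\mathcal R\in L^{-1}(\mathbb C^{p\times p\times l}_{upp+})$; $qf(\mathcal A):=\mathcal Q$. A retraction on a manifold $M$ is a smooth map $R:TM\to M$ such that, with $R_x$ its restriction to $T_xM$, $R_x(0_x)=x$ and $\mathrm DR_x(0_x)$ is the identity of $T_xM$. *)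

(* Defs.v *)
From HB Require Import structures.
From mathcomp Require Import all_boot all_order all_algebra.
From mathcomp Require Import all_classical all_reals all_analysis.
From mathcomp.real_closed Require Import complex.

Set Implicit Arguments.
Unset Strict Implicit.
Unset Printing Implicit Defensive.

Import Order.TTheory GRing.Theory Num.Theory.
Import numFieldNormedType.Exports.
Local Open Scope classical_set_scope.
Local Open Scope ring_scope.

Section TensorDefs.
Variable R : realType.

(* A real n x p x l tensor A is represented by its unfolding unfold(A),
   the (l*n) x p matrix obtained by stacking the frontal slices
   A^(1), ..., A^(l) vertically: row k*n + i of the unfolding is row i of
   the frontal slice A^(k+1) (0-based k).  unfold/fold are then identities. *)
Definition tensor (n p l : nat) := 'M[R]_(l * n, p).

(* decomposition of a row index r < l*n of the unfolding into (k, i),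
   with r = k*n + i (mxvec_index k i has value k*n + i). *)
Definition blk_idx (l n : nat) (r : 'I_(l * n)) : 'I_l * 'I_n :=
  enum_val (cast_ord (esym (mxvec_cast l n)) r).

(* m mod l as an element of 'I_l (a witness k0 : 'I_l ensures l > 0) *)
Definition ord_mod (l : nat) (k0 : 'I_l) (m : nat) : 'I_l :=
  Ordinal (ltn_pmod m (leq_ltn_trans (leq0n k0) (ltn_ord k0))).

Definition slice n p l (A : tensor n p l) (k : 'I_l) : 'M[R]_(n, p) :=
  \matrix_(i < n, j < p) A (mxvec_index k i) j.

Definition of_slices n p l (F : 'I_l -> 'M[R]_(n, p)) : tensor n p l :=
  \matrix_(r < l * n, j < p) F (blk_idx r).1 (blk_idx r).2 j.

Definition bcirc n p l (A : tensor n p l) : 'M[R]_(l * n, l * p) :=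
  \matrix_(r < l * n, c < l * p)
     slice A (ord_mod (blk_idx r).1 ((blk_idx r).1 + l - (blk_idx c).1))
       (blk_idx r).2 (blk_idx c).2.

(* t-product  A * B = fold (bcirc A * unfold B) *)
Definition tprod n p q l (A : tensor n p l) (B : tensor p q l) : tensor n q l :=
  bcirc A *m B.

Definition ttr n p l (A : tensor n p l) : tensor p n l :=
  of_slices (fun k : 'I_l => (slice A (ord_mod k (l - k)))^T).

Definition tid (p l : nat) : tensor p p l :=
  of_slices (fun k : 'I_l => if (k == 0 :> nat) then 1%:M else 0).

Definition Stiefel n p l : set (tensor n p l) :=
  [set X | tprod (ttr X) X = tid p l].

Definition tangent_space (V : normedModType R) (M : set V) (x : V) : set V :=
  [set v | exists c : R -> V,
     (\forall t \near (0 : R), M (c t)) /\ c 0 = x /\ is_derive (0 : R) 1 c v].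

Local Open Scope complex_scope.

Definition omega (l : nat) : R[i] :=
  (cos (2 * pi / l%:R)) -i* (sin (2 * pi / l%:R)).

Definition dft n p l (A : tensor n p l) (k : 'I_l) : 'M[R[i]]_(n, p) :=
  \sum_(j < l) (omega l ^+ (k * j)) *: map_mx (fun x : R => x%:C) (slice A j).

Local Close Scope complex_scope.

Definition in_Linv_Cstar n p l (A : tensor n p l) : Prop :=
  forall k : 'I_l, \rank (dft A k) = p.

Definition in_Linv_Cupp p l (A : tensor p p l) : Prop :=
  forall k : 'I_l,
    (forall i j : 'I_p, (j < i)%N -> dft A k i j = 0) /\
    (forall i : 'I_p, exists r : R, 0 < r /\ dft A k i i = r%:C%C).

Definition tQR n p l (A : tensor n p l) (Q : tensor n p l) (Rt : tensor p p l)
  : Prop := @Stiefel n p l Q /\ in_Linv_Cupp Rt /\ A = tprod Q Rt.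

(* qf(A): the Q factor of the (unique) t-QR decomposition of A *)
Definition qf n p l (A : tensor n p l) : tensor n p l :=
  xget 0 [set Q | exists Rt, tQR A Q Rt].

End TensorDefs.
Arguments Stiefel : clear implicits.

Section Smooth.
Variable R : realType.

(* f is C^k on the open set U: f is continuous on U and, for k > 0, all
   directional derivatives 'D_v f exist on U and are C^(k-1) on U
   (in finite dimension this is the usual C^k). *)
Fixpoint Ck_on (V W : normedModType R) (k : nat) (U : set V) (f : V -> W)
  : Prop :=
  (forall x, U x -> {for x, continuous f}) /\
  match k with
  | 0 => True
  | k'.+1 => forall v : V,
      (forall x, U x -> derivable f x v) /\ Ck_on k' U (fun x => derive f x v)
  end.

Definition smooth_on (V W : normedModType R) (U : set V) (f : V -> W) :=
  forall k, Ck_on k U f.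

Definition smooth_on_subset (V W : normedModType R) (S : set V) (f : V -> W) :=
  forall s, S s -> exists U : set V, open U /\ U s /\
    exists g : V -> W, smooth_on U g /\ (forall y, S y -> U y -> g y = f y).

Definition tangent_bundle (V : normedModType R) (M : set V) : set (V * V) :=
  [set xv | M xv.1 /\ tangent_space M xv.1 xv.2].

(* Retraction on M: a smooth map Rt : TM -> M (given as a map on V x V,
   only its values on TM matter) with Rt_x(0_x) = x and
   DRt_x(0_x) = id on T_x M, i.e. d/dt Rt_x(t v)|_{t=0} = v. *)
Definition is_retraction (V : normedModType R) (M : set V) (Rt : V * V -> V)
  : Prop :=
  smooth_on_subset (tangent_bundle M) Rt /\
  (forall x v, M x -> tangent_space M x v -> M (Rt (x, v))) /\
  (forall x, M x -> Rt (x, 0) = x) /\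
  (forall x v, M x -> tangent_space M x v ->
     is_derive (0 : R) 1 (fun t : R => Rt (x, t *: v)) v).

End Smooth.

(* Main.v *)
Require Import Defs.
From HB Require Import structures.
From mathcomp Require Import all_boot all_order all_algebra.
From mathcomp Require Import all_classical all_reals all_analysis.
From mathcomp Require Import ring lra zify.
From mathcomp.real_closed Require Import complex.
Set Implicit Arguments.
Unset Strict Implicit.
Unset Printing Implicit Defensive.

Import Order.TTheory GRing.Theory Num.Theory.
Import numFieldNormedType.Exports.
Local Open Scope classical_set_scope.
Local Open Scope ring_scope.

(** The DFT turns the t-product into slicewise products, so the t-QR
    decomposition is a QR decomposition of each frequency slice; Gram-Schmidt
    commutes with complex conjugation, hence preserves the conjugation symmetry
    that characterizes DFTs of real tensors, and qf is the inverse DFT of the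
    slicewise Gram-Schmidt process.

    A tangent vector satisfies X^T * V + V^T * X = 0, so each slice of X + V has
    Gram matrix I + V^H V and full column rank.

    Gram-Schmidt is built from linear forms by ring operations, inverses and
    square roots of positive quantities. This class of functions is stable under
    directional derivatives, hence consists of smooth functions.

    For the derivative at 0, V is the velocity of a curve c in St, and
    qf (c t) = c t. As qf is differentiable at X and t |-> X + t V has the same
    velocity as c, the image curve qf (X + t V) has velocity V as well. *)

(** * QR decomposition of complex matrices *)

Section ComplexQR.
Context {R : realType}.
Local Notation C := R[i].
Local Open Scope complex_scope.

Definition ctr m n (M : 'M[C]_(m, n)) : 'M[C]_(n, m) := map_mx (@conjc R) M^T.

Lemma ctr_mul m n k (A : 'M[C]_(m, n)) (B : 'M[C]_(n, k)) :
  ctr (A *m B) = ctr B *m ctr A.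
Proof. by rewrite /ctr trmx_mul map_mxM. Qed.

Lemma ctrK m n (A : 'M[C]_(m, n)) : ctr (ctr A) = A.
Proof. by apply/matrixP => i j; rewrite !mxE conjcK. Qed.

Lemma ctrD m n (A B : 'M[C]_(m, n)) : ctr (A + B) = ctr A + ctr B.
Proof. by rewrite /ctr linearD map_mxD. Qed.

Lemma ctr_row_mx m n1 n2 (A : 'M[C]_(m, n1)) (B : 'M[C]_(m, n2)) :
  ctr (row_mx A B) = col_mx (ctr A) (ctr B).
Proof. by rewrite /ctr tr_row_mx map_col_mx. Qed.

Local Notation re := (@complex.Re R).
Local Notation im := (@complex.Im R).

Definition sqn m (a : 'cV[C]_m) : R := \sum_i (re (a i 0) ^+ 2 + im (a i 0) ^+ 2).

Lemma sqn_ge0 m (a : 'cV[C]_m) : 0 <= sqn a.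
Proof. by apply: sumr_ge0 => i _; rewrite addr_ge0 ?sqr_ge0. Qed.

Lemma sqn_eq0 m (a : 'cV[C]_m) : sqn a = 0 -> a = 0.
Proof.
move=> /psumr_eq0P a0; apply/matrixP => i j; rewrite ord1 mxE.
have /eqP := a0 (fun i _ => addr_ge0 (sqr_ge0 _) (sqr_ge0 _)) i isT.
rewrite paddr_eq0 ?sqr_ge0// !sqrf_eq0.
by case: (a i 0) => x y /= /andP[/eqP -> /eqP ->].
Qed.

Lemma ctr_mul_col m (a : 'cV[C]_m) : ctr a *m a = ((sqn a)%:C)%:M.
Proof.
apply/matrixP => i j; rewrite !ord1 !mxE eqxx mulr1n /sqn rmorph_sum.
apply: eq_bigr => k _; rewrite !mxE.
by case: (a k 0) => x y; simpc => /=; congr Complex; ring.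
Qed.

(** Full column rank, phrased on column vectors so that it combines with norm identities; the
    library rank is about rows, whence the transposes in [mxinj_rank]. *)
Definition mxinj m n (M : 'M[C]_(m, n)) := forall x : 'cV_n, M *m x = 0 -> x = 0.

Lemma mxinj_rank m n (M : 'M[C]_(m, n)) : \rank M = n <-> mxinj M.
Proof.
rewrite -mxrank_tr; split => [/eqP MTfree x Mx0|Minj].
  apply: trmx_inj; apply/eqP; rewrite trmx0 -(mulmx_free_eq0 _ MTfree).
  by rewrite -trmx_mul Mx0 trmx0.
apply/eqP/inj_row_free => v vM0; apply: trmx_inj; rewrite trmx0; apply: Minj.
by apply: trmx_inj; rewrite trmx_mul trmxK vM0 trmx0.
Qed.

(** If [ctr M *m M] kills [v], then the squared norm of [M *m v] vanishes. Full column rank thus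
    becomes the nonvanishing of a polynomial in the real and imaginary parts of the entries, which
    makes it an open condition. *)
Lemma mxinj_det m n (M : 'M[C]_(m, n)) : mxinj M <-> \det (ctr M *m M) != 0.
Proof.
rewrite -unitfE -[_ \is a _]/(_ \in unitmx); split => [Minj|U x Mx0].
  rewrite -unitmx_tr -row_free_unit; apply: inj_row_free => v vM0.
  have Mv0 : ctr M *m M *m v^T = 0.
    by apply: trmx_inj; rewrite trmx_mul trmxK vM0 trmx0.
  apply: trmx_inj; rewrite trmx0; apply: Minj.
  apply: sqn_eq0; apply: complexI; rewrite rmorph0.
  have /matrixP/(_ 0 0) := ctr_mul_col (M *m v^T).
  by rewrite ctr_mul -mulmxA [X in _ *m X]mulmxA Mv0 mulmx0 !mxE eqxx.
by rewrite -[x](mulKmx U) -mulmxA Mx0 !mulmx0.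
Qed.

Definition upp p (T : 'M[C]_p) :=
  (forall i j : 'I_p, (j < i)%N -> T i j = 0) /\
  (forall i : 'I_p, exists r : R, 0 < r /\ T i i = r%:C).

Lemma upp_unit p (T : 'M[C]_p) : upp T -> T \in unitmx.
Proof.
(* [det_trig] is about lower triangular matrices, hence the transpose. *)
move=> [Tlow Tdiag]; rewrite -unitmx_tr unitmxE det_trig; last first.
  by apply/is_trig_mxP => i j ij; rewrite mxE Tlow.
rewrite unitfE; apply/prodf_neq0 => i _; rewrite mxE.
have [r [r0 ->]] := Tdiag i.
by apply: contra_neq (lt0r_neq0 r0) => /complexI.
Qed.

Lemma upp_block p (r : R) (s : 'rV[C]_p) (T : 'M[C]_p) : 0 < r -> upp T ->
  upp (block_mx (r%:C)%:M s 0 T : 'M[C]_(1 + p)).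
Proof.
move=> r0 [Tlow Tdiag]; split=> [i j|i].
  case: (split_ordP i) => i' ->; case: (split_ordP j) => j' ->.
  - by rewrite !ord1.
  - by rewrite /= !ord1 /= ltn0.
  - by move=> _; rewrite block_mxEdl mxE.
  - by rewrite /= ltn_add2l block_mxEdr => /Tlow.
case: (split_ordP i) => i' ->.
  by exists r; split; rewrite // block_mxEul mxE ord1.
by have [t [t0 tE]] := Tdiag i'; exists t; split; rewrite // block_mxEdr.
Qed.

(** Peels off the first row and column, matching the recursion of [gs] on columns. *)
Lemma upp_blockP p (T : 'M[C]_(1 + p)) : upp T ->
  exists (r : R) (s : 'rV[C]_p) (T' : 'M[C]_p),
    [/\ 0 < r, upp T' & T = block_mx (r%:C)%:M s 0 T'].
Proof.
move=> [Tlow Tdiag]; have [r [r0 rE]] := Tdiag (lshift p 0).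
exists r, (ursubmx T), (drsubmx T); split => //.
  split=> [i j ji|i]; first by rewrite !mxE Tlow//= ltn_add2l.
  by have [t [t0 tE]] := Tdiag (rshift 1 i); exists t; rewrite !mxE.
rewrite -[LHS]submxK; congr block_mx.
  by apply/matrixP => i j; rewrite !ord1 !mxE eqxx.
by apply/matrixP => i j; rewrite ord1 !mxE Tlow.
Qed.

Definition normalize m (a : 'cV[C]_m) : 'cV[C]_m := ((Num.sqrt (sqn a))^-1)%:C *: a.

Lemma normalize_unit m (a : 'cV[C]_m) : a != 0 ->
  ctr (normalize a) *m normalize a = 1%:M.
Proof.
move=> a0; have sa0 : Num.sqrt (sqn a) != 0.
  rewrite gt_eqF// sqrtr_gt0 lt_def sqn_ge0 andbT.
  by apply: contra_neq a0; exact: sqn_eq0.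
have -> : ctr (normalize a) = ((Num.sqrt (sqn a))^-1)%:C *: ctr a.
  by rewrite /ctr linearZ /= map_mxZ /= oppr0.
rewrite -scalemxAl -scalemxAr scalerA ctr_mul_col scale_scalar_mx.
congr _%:M; rewrite -!rmorphM -[1]/(1%:C); congr _%:C.
by rewrite -[X in _ * X = _](sqr_sqrtr (sqn_ge0 a)); field.
Qed.

(* Gram-Schmidt on the columns; junk values on rank-deficient matrices, where
   normalize divides by 0. *)
Fixpoint gs n p {struct p} : 'M[C]_(n, p) -> 'M[C]_(n, p) :=
  match p with
  | 0 => fun M => M
  | p'.+1 => fun M : 'M[C]_(n, 1 + p') =>
      let q := normalize (lsubmx M) in
      row_mx q (gs (rsubmx M - q *m (ctr q *m rsubmx M)))
  end.

(** The first column of [M] is [r] times a unit vector [q] with [r > 0], so [r] is its norm and [q]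
    its normalization. Orthogonality then identifies the projection coefficients with [s], so the
    deflated block is the remaining part of [Q] times [T2], and induction applies. *)
Lemma gs_uniq n p (Q M : 'M[C]_(n, p)) (T : 'M[C]_p) :
  ctr Q *m Q = 1%:M -> upp T -> M = Q *m T -> Q = gs M.
Proof.
elim: p Q M T => [|p IHp] Q M T.
  by move=> *; apply/matrixP => i [].
rewrite -[p.+1]/(1 + p)%N in Q M T *.
rewrite -(hsubmxK Q); move: (lsubmx Q) (rsubmx Q) => q Q2 {Q}.
rewrite ctr_row_mx mul_col_row (scalar_mx_block 1) => /eq_block_mx[qq qQ Qq QQ].
move=> /upp_blockP[r [s [T2 [r0 T2u ->]]]].
rewrite mul_row_block mulmx0 addr0 => ME.
have aE : lsubmx M = r%:C *: q.
  by rewrite ME row_mxKl -mul_mx_scalar.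
have saE : sqn (lsubmx M) = r ^+ 2.
  apply: complexI; have /matrixP/(_ 0 0) := ctr_mul_col (lsubmx M).
  rewrite [RHS]mxE eqxx mulr1n => <-; rewrite aE.
  have -> : ctr (r%:C *: q) = r%:C *: ctr q by rewrite /ctr linearZ /= map_mxZ /= oppr0.
  by rewrite -scalemxAl -scalemxAr scalerA qq !mxE eqxx mulr1 rmorphXn.
have qE : normalize (lsubmx M) = q.
  rewrite /normalize saE sqrtr_sqr gtr0_norm// aE scalerA -rmorphM mulVf ?gt_eqF//.
  by rewrite scale1r.
rewrite /= qE; congr row_mx; apply: (IHp _ _ T2) => //.
rewrite ME row_mxKr mulmxDr mulmxA qq mul1mx mulmxA qQ mul0mx addr0.
by rewrite addrAC subrr add0r.
Qed.

Lemma mxinj_lsubmx_neq0 n p (M : 'M[C]_(n, 1 + p)) : mxinj M -> lsubmx M != 0.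
Proof.
move=> Minj; apply/eqP => a0; have := Minj (col_mx 1%:M 0).
rewrite -(hsubmxK M) a0 mul_row_col mul0mx mulmx0 addr0 => /(_ erefl)/eqP.
by rewrite col_mx_eq0 => /andP[/eqP/matrixP/(_ 0 0)/eqP]; rewrite !mxE oner_eq0.
Qed.

(** Deflation subtracts multiples of the first column of [M], so a kernel vector of the deflated
    block extends to one of [M]. *)
Lemma mxinj_deflate n p (M : 'M[C]_(n, 1 + p)) : mxinj M ->
  mxinj (rsubmx M - normalize (lsubmx M) *m (ctr (normalize (lsubmx M)) *m rsubmx M)).
Proof.
move=> Minj x Mx0; set q := normalize _ in Mx0.
(* The projection along [q] is rewritten as a multiple of the unnormalized first column; [y] is its
   coefficient. *)
pose y := - ((Num.sqrt (sqn (lsubmx M)))^-1)%:C *: (ctr q *m rsubmx M *m x).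
suff /Minj/(congr1 dsubmx) : M *m col_mx y x = 0 by rewrite col_mxKd linear0.
rewrite -{1}(hsubmxK M) mul_row_col -[RHS]Mx0 mulmxBl addrC; congr (_ + _).
by rewrite /y scaleNr mulmxN -scalemxAr scalemxAl !mulmxA.
Qed.

Lemma gs_QR n p (M : 'M[C]_(n, p)) : mxinj M ->
  ctr (gs M) *m gs M = 1%:M /\ exists T, upp T /\ M = gs M *m T.
Proof.
elim: p M => [|p IHp] M Minj.
  split; first by apply/matrixP => -[].
  by exists 0; split; [split=> -[]|apply/matrixP => i []].
rewrite -[p.+1]/(1 + p)%N in M Minj *.
have a0 := mxinj_lsubmx_neq0 Minj; have B'inj := mxinj_deflate Minj.
rewrite /=; move: a0 B'inj (hsubmxK M).
move: (lsubmx M) (rsubmx M) => a B a0.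
set q := normalize a; set B' := B - _ => B'inj <-.
have qq : ctr q *m q = 1%:M by exact: normalize_unit.
have sa0 : 0 < Num.sqrt (sqn a).
  rewrite sqrtr_gt0 lt_def sqn_ge0 andbT.
  by apply: contra_neq a0; exact: sqn_eq0.
have aE : a = (Num.sqrt (sqn a))%:C *: q.
  by rewrite /q /normalize scalerA -rmorphM mulfV ?gt_eqF// scale1r.
have qB' : ctr q *m B' = 0 by rewrite mulmxBr (mulmxA _ q) qq mul1mx subrr.
have [QQ [T [Tu BE]]] := IHp _ B'inj.
(* Orthogonality to [B'] passes to its Q factor because the triangular factor is invertible. *)
have qQ : ctr q *m gs B' = 0.
  have : ctr q *m B' = 0 by [].
  rewrite {1}BE mulmxA => /(congr1 (mulmx^~ (invmx T))).
  by rewrite (mulmxK (upp_unit Tu)) mul0mx.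
split.
  rewrite ctr_row_mx mul_col_row qq qQ QQ (scalar_mx_block 1); congr block_mx.
  by rewrite -[q in LHS]ctrK -ctr_mul qQ /ctr trmx0 map_mx0.
exists (block_mx ((Num.sqrt (sqn a))%:C)%:M (ctr q *m B) 0 T); split.
  exact: upp_block.
rewrite mul_row_block mulmx0 addr0 mul_mx_scalar -aE; congr row_mx.
by rewrite -BE addrC subrK.
Qed.

End ComplexQR.

(** * Discrete Fourier transform of tensors *)

Section Fourier.
Context {R : realType}.
Local Notation C := R[i].
Local Open Scope complex_scope.
Local Notation re := (@complex.Re R).
Local Notation toC := (fun x : R => x%:C).
Local Notation cj := (@conjc R).
Local Notation w l := (omega R l).

Lemma omegaX l m :
  w l ^+ m = cos (m%:R * (2 * pi / l%:R)) -i* sin (m%:R * (2 * pi / l%:R)).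
Proof.
elim: m => [|m IHm]; first by rewrite expr0 mul0r cos0 sin0 oppr0.
rewrite exprS IHm; rewrite /omega; move: (2 * pi / l%:R) => t.
have -> : m.+1%:R * t = m%:R * t + t :> R by rewrite -(natr1 m) mulrDl mul1r.
rewrite cosD sinD; simpc.
by congr Complex; ring.
Qed.

Lemma omega_unity l : (0 < l)%N -> w l ^+ l = 1.
Proof.
move=> l0; rewrite omegaX mulrCA mulfV ?pnatr_eq0 -?lt0n// mulr1 mulr2n.
by rewrite -mulr2n mulr_natl cos2pi sin2pi oppr0.
Qed.

Lemma omega_neq1 l m : (0 < m < l)%N -> w l ^+ m != 1.
Proof.
move=> /andP[m0 ml]; rewrite omegaX; apply/eqP => -[cos1 _].
have l0 : (0 : R) < l%:R by rewrite ltr0n; lia.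
(* Half the angle of [w l ^+ m]: it lies strictly between 0 and pi, so the real part, 1 - 2
   sin(x)^2, is below 1. *)
pose x : R := m%:R / l%:R * pi.
have xE : m%:R * (2 * pi / l%:R) = x *+ 2 by rewrite /x mulr2n; ring.
have sx : 0 < sin x.
  apply: sin_gt0_pi; apply/andP; split.
    by rewrite mulr_gt0 ?pi_gt0// divr_gt0// ltr0n.
  by rewrite gtr_pMl ?pi_gt0// ltr_pdivrMr// mul1r ltr_nat.
move: cos1; rewrite xE cos_mulr2n cos2sin2.
by have := exprn_gt0 2 sx; lra.
Qed.

Lemma omega_prim l : (0 < l)%N -> l.-primitive_root (w l).
Proof.
move=> l0; rewrite /primitive_root_of_unity l0 /=; apply/forallP => -[i il].
rewrite unity_rootE /=; case: (ltngtP i.+1 l) (il) => // [il' _|-> _].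
  by rewrite (negPf (omega_neq1 _)).
by rewrite omega_unity ?eqxx.
Qed.

Lemma conj_omega l : cj (w l) * w l = 1.
Proof.
have := cos2Dsin2 (2 * pi / l%:R : R).
rewrite /omega; set c := cos _; set s := sin _ => cs.
apply/eqP; rewrite eq_complex /= -cs.
by apply/andP; split; apply/eqP; ring.
Qed.

Lemma omega_eqmod l a b : (0 < l)%N -> a = b %[mod l] -> w l ^+ a = w l ^+ b.
Proof. by move=> l0 ab; apply/eqP; rewrite (eq_prim_root_expr (omega_prim l0)); apply/eqP. Qed.

Lemma conj_omegaX l a b : (0 < l)%N -> (l %| a + b)%N ->
  cj (w l ^+ a) = w l ^+ b.
Proof.
move=> l0 /dvdnP[c abE].
have ab : w l ^+ b * w l ^+ a = 1.
  by rewrite -exprD addnC abE mulnC exprM omega_unity// expr1n.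
rewrite -[LHS]mul1r -ab -mulrA -[w l ^+ a * _]mulrC rmorphXn -exprMn.
by rewrite conj_omega expr1n mulr1.
Qed.

(** Orthogonality of the characters of Z/l: a geometric sum whose ratio is an l-th root of unity,
    equal to 1 only when [i = j]. *)
Lemma sum_omega l (i j : 'I_l) :
  \sum_(k < l) cj (w l ^+ (k * i)) * w l ^+ (k * j) = if i == j then l%:R else 0.
Proof.
have l0 : (0 < l)%N by exact: leq_ltn_trans (ltn_ord i).
pose z := w l ^+ (l - i + j).
have zE (k : 'I_l) : cj (w l ^+ (k * i)) * w l ^+ (k * j) = z ^+ k.
  rewrite (@conj_omegaX l _ (k * (l - i)))//; last first.
    by rewrite -mulnDr subnKC ?dvdn_mull// ltnW.
  by rewrite -exprD -mulnDr mulnC exprM.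
under eq_bigr do rewrite zE.
case: eqVneq => [ij|ij].
  have -> : z = 1.
    by rewrite /z -(expr0 (w l)); apply: omega_eqmod => //; rewrite ij subnK ?modnn ?mod0n// ltnW.
  by under eq_bigr do rewrite expr1n; rewrite sumr_const card_ord.
have z1 : z - 1 != 0.
  rewrite subr_eq0 /z -(expr0 (w l)) (eq_prim_root_expr (omega_prim l0)) mod0n.
  (* The exponent lies strictly between 0 and 2l, so only the quotient 1 is possible, and it gives
     [i = j]. *)
  apply: contra ij => /dvdnP[q qE].
  apply/eqP/val_inj => /=.
  have := ltn_ord i; have := ltn_ord j.
  by case: q qE => [|[|q]]; rewrite ?mulSn; lia.
apply: (mulfI z1); rewrite mulr0 -subrX1 /z -exprM mulnC exprM omega_unity//.
by rewrite expr1n subrr.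
Qed.

Lemma ordl_gt0 l (k : 'I_l) : (0 < l)%N.
Proof. exact: leq_ltn_trans (ltn_ord k). Qed.

Lemma blk_idxK l n (k : 'I_l) (i : 'I_n) : blk_idx (mxvec_index k i) = (k, i).
Proof. by rewrite /blk_idx /mxvec_index cast_ordK enum_rankK. Qed.

Lemma blk_idx_inv l n (r : 'I_(l * n)) : mxvec_index (blk_idx r).1 (blk_idx r).2 = r.
Proof. by rewrite /mxvec_index -surjective_pairing enum_valK cast_ordKV. Qed.

Lemma sum_blk (V : nmodType) l n (F : 'I_(l * n) -> V) :
  \sum_r F r = \sum_(k < l) \sum_(i < n) F (mxvec_index k i).
Proof.
rewrite pair_bigA (reindex (fun ki : 'I_l * 'I_n => mxvec_index ki.1 ki.2)) //=.
exists (@blk_idx l n) => [[k i] _|r _]; first exact: blk_idxK.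
exact: blk_idx_inv.
Qed.

Lemma slice_of_slices n p l (F : 'I_l -> 'M[R]_(n, p)) k :
  slice (of_slices F) k = F k.
Proof. by apply/matrixP => i j; rewrite !mxE blk_idxK. Qed.

Lemma slice_inj n p l (A B : tensor R n p l) : (forall k, slice A k = slice B k) -> A = B.
Proof.
move=> AB; apply/matrixP => r j; rewrite -(blk_idx_inv r).
by have /matrixP/(_ (blk_idx r).2 j) := AB (blk_idx r).1; rewrite !mxE.
Qed.

Lemma slice_tprod n p q l (A : tensor R n p l) (B : tensor R p q l) k :
  slice (tprod A B) k = \sum_(j < l) slice A (ord_mod k (k + l - j)) *m slice B j.
Proof.
apply/matrixP => i j; rewrite !mxE sum_blk summxE; apply: eq_bigr => m _.
by rewrite mxE; apply: eq_bigr => a _; rewrite !mxE !blk_idxK.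
Qed.

Lemma sliceD n p l (A B : tensor R n p l) k : slice (A + B) k = slice A k + slice B k.
Proof. by apply/matrixP => i j; rewrite !mxE. Qed.

Lemma dftD n p l (A B : tensor R n p l) k : dft (A + B) k = dft A k + dft B k.
Proof.
rewrite /dft -big_split; apply: eq_bigr => j _.
by rewrite sliceD (map_mxD (real_complex R)) scalerDr.
Qed.

Lemma modn_addK l (m j : 'I_l) : (((m + j) %% l + l - j) %% l)%N = m.
Proof.
have jl : (j <= (m + j) %% l + l)%N by rewrite ltnW// ltn_addl.
rewrite -[RHS](modn_small (ltn_ord m)); apply/eqP.
by rewrite -(eqn_modDr j) subnK// modnDr modn_mod.
Qed.

(** The convolution theorem: for each slice index [j] of [B], the output index is reindexed as
    [m + j] modulo [l], and the character splits as a product. *)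
Lemma dft_tprod n p q l (A : tensor R n p l) (B : tensor R p q l) k :
  dft (tprod A B) k = dft A k *m dft B k.
Proof.
have l0 := ordl_gt0 k.
rewrite /dft mulmx_sumr.
under eq_bigr do rewrite slice_tprod (map_mx_sum (real_complex R)) scaler_sumr.
rewrite exchange_big; apply: eq_bigr => j _ /=.
rewrite mulmx_suml (reindex (fun m : 'I_l => ord_mod m (m + j))) /=; last first.
  exists (fun m : 'I_l => ord_mod m (m + l - j)) => m _; apply: val_inj => /=.
    exact: modn_addK.
  by rewrite modnDml subnK ?modnDr ?modn_small// ltnW// ltn_addl.
apply: eq_bigr => m _.
rewrite -scalemxAl -scalemxAr scalerA (map_mxM (real_complex R)).
rewrite (_ : ord_mod _ _ = m); last by apply: val_inj; exact: modn_addK.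
congr (_ *: _); rewrite -exprD -mulnDr; apply: omega_eqmod => //.
by rewrite modnMmr.
Qed.

(** Negation in Z/l, which serves both for the slice permutation of the transpose and for conjugate
    frequencies. *)
Definition ord_neg l (k : 'I_l) := ord_mod k (l - k).

Lemma ord_negK l : involutive (@ord_neg l).
Proof.
move=> k; apply: val_inj => /=; have := ltn_ord k.
case: (posnP k) => [->|k0]; first by rewrite subn0 modnn subn0 modnn.
by move=> kl; rewrite (@modn_small (l - k)) ?modn_small; lia.
Qed.

Lemma ord_neg_dvd l (k : 'I_l) : (l %| k + ord_neg k)%N.
Proof. by rewrite /dvdn /= modnDmr subnKC ?modnn// ltnW. Qed.

Lemma conjcM_real (z : C) (x : R) : cj (z * x%:C) = cj z * x%:C.
Proof. by case: z => a b; simpc; congr Complex; ring. Qed.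

Lemma dft_ttr n p l (A : tensor R n p l) k : dft (ttr A) k = ctr (dft A k).
Proof.
have l0 := ordl_gt0 k.
apply/matrixP => a b.
rewrite /dft (reindex_inj (inv_inj (@ord_negK l))) !mxE !summxE rmorph_sum.
apply: eq_bigr => j _; rewrite slice_of_slices -/(ord_neg _) ord_negK.
rewrite !mxE [RHS]conjcM_real; congr (_ * _).
by rewrite (@conj_omegaX l _ (k * ord_neg j))// -mulnDr dvdn_mull// ord_neg_dvd.
Qed.

(** The slices of [A] are real, so conjugation only inverts the roots of unity. *)
Lemma dft_conj n p l (A : tensor R n p l) k :
  dft A (ord_neg k) = map_mx cj (dft A k).
Proof.
have l0 := ordl_gt0 k.
apply/matrixP => a b; rewrite /dft !mxE !summxE rmorph_sum.
apply: eq_bigr => j _; rewrite !mxE [RHS]conjcM_real; congr (_ * _).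
by rewrite (@conj_omegaX l _ (ord_neg k * j))// -mulnDl dvdn_mulr// ord_neg_dvd.
Qed.

Lemma dft_tid p l k : dft (tid R p l) k = 1%:M.
Proof.
have l0 := ordl_gt0 k.
rewrite /dft (bigD1 (Ordinal l0))//= muln0 expr0 scale1r slice_of_slices /=.
rewrite (map_mx1 (real_complex R)) big1 ?addr0// => j j0.
rewrite slice_of_slices ifF ?(map_mx0 (real_complex R)) ?scaler0//.
by apply: contraNF j0 => /eqP jE; apply/eqP/val_inj.
Qed.

(** Fourier inversion multiplied through by [l], a consequence of [sum_omega]. *)
Lemma dftK n p l (A : tensor R n p l) (j : 'I_l) :
  \sum_(k < l) cj (w l ^+ (k * j)) *: dft A k = l%:R *: map_mx toC (slice A j).
Proof.
rewrite /dft.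
under eq_bigr do rewrite scaler_sumr; rewrite exchange_big /=.
under eq_bigr => i _ do (under eq_bigr do rewrite scalerA; rewrite -scaler_suml sum_omega).
rewrite (bigD1 j)//= eqxx big1 ?addr0// => i ij.
by rewrite eq_sym (negPf ij) scale0r.
Qed.

Lemma dft_inj n p l (A B : tensor R n p l) : (forall k, dft A k = dft B k) -> A = B.
Proof.
move=> AB; apply: slice_inj => k; have l0 := ordl_gt0 k.
have := dftK A k; under eq_bigr do rewrite AB; rewrite dftK.
have lC0 : l%:R != 0 :> C by rewrite pnatr_eq0 -lt0n.
move=> /(scalerI lC0)/matrixP ABk; apply/matrixP => i j.
by have := ABk i j; rewrite !mxE => /complexI.
Qed.

Lemma map_conjcZ m n (a : C) (M : 'M[C]_(m, n)) : map_mx cj (a *: M) = cj a *: map_mx cj M.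
Proof. by apply/matrixP => i j; rewrite !mxE; exact: rmorphM. Qed.

Lemma map_conjcK m n (M : 'M[C]_(m, n)) : map_mx cj (map_mx cj M) = M.
Proof. by apply/matrixP => i j; rewrite !mxE conjcK. Qed.

Lemma map_conjc_sum m n l (F : 'I_l -> 'M[C]_(m, n)) :
  map_mx cj (\sum_i F i) = \sum_i map_mx cj (F i).
Proof. exact: (map_mx_sum cj). Qed.

Lemma map_conjc_fixed m n (M : 'M[C]_(m, n)) :
  map_mx cj M = M -> map_mx toC (map_mx re M) = M.
Proof.
move=> MJ; apply/matrixP => i j; have := congr1 (fun N : 'M[C]_(m, n) => N i j) MJ.
rewrite !mxE; case: (M i j) => x y [yN]; apply/eqP; rewrite eq_complex /= eqxx /=.
by apply/eqP; have {}yN : - y = y :> R by []; lra.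
Qed.

(** Taking real parts produces a real tensor; for a conjugation-symmetric family the inverse
    transform is already real, so nothing is lost. *)
Definition idft n p l (F : 'I_l -> 'M[C]_(n, p)) : tensor R n p l :=
  of_slices (fun j => map_mx re (l%:R^-1 *: \sum_(k < l) cj (w l ^+ (k * j)) *: F k)).

Lemma idftK n p l (F : 'I_l -> 'M[C]_(n, p)) k :
  (forall k, F (ord_neg k) = map_mx cj (F k)) -> dft (idft F) k = F k.
Proof.
move=> FJ; have l0 := ordl_gt0 k.
pose S j := l%:R^-1 *: \sum_(k < l) cj (w l ^+ (k * j)) *: F k.
have SJ (j : 'I_l) : map_mx cj (S j) = S j.
  rewrite /S map_conjcZ map_conjc_sum conjc_inv conjc_nat; congr (_ *: _).
  (* Conjugation exchanges the terms of opposite frequencies, so the whole sum is fixed. *)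
  rewrite (reindex_inj (inv_inj (@ord_negK l))); apply: eq_bigr => i _.
  rewrite FJ map_conjcZ map_conjcK conjcK.
  congr (_ *: _).
  by rewrite (@conj_omegaX l _ (ord_neg i * j))// -mulnDl dvdn_mulr// ord_neg_dvd.
have Sre (j : 'I_l) : map_mx toC (map_mx re (S j)) = S j by exact: map_conjc_fixed.
rewrite /dft.
have lC0 : l%:R != 0 :> C by rewrite pnatr_eq0 -lt0n.
under eq_bigr do rewrite slice_of_slices Sre /S scalerA scaler_sumr.
rewrite exchange_big /= (bigD1 k)//=.
have E (i : 'I_l) : \sum_(j < l) (w l ^+ (k * j) / l%:R) *: (cj (w l ^+ (i * j)) *: F i) =
   (if i == k then 1 else 0) *: F i.
  under eq_bigr do rewrite scalerA; rewrite -scaler_suml; congr (_ *: _).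
  (* Orthogonality is used with the slice index as summation variable, hence the commuted exponents
     below. *)
  rewrite (_ : (if i == k then 1 else 0) = (if i == k then l%:R else 0) / l%:R); last first.
    by case: ifP => _; rewrite ?mulfV ?mul0r.
  rewrite -sum_omega mulr_suml; apply: eq_bigr => j _.
  by rewrite mulrAC (mulnC k) (mulnC i) [w _ ^+ _ * _]mulrC.
rewrite E eqxx scale1r big1 ?addr0// => i ik.
by rewrite E (negPf ik) scale0r.
Qed.

Lemma StiefelP n p l (X : tensor R n p l) :
  Stiefel R n p l X <-> forall k, ctr (dft X k) *m dft X k = 1%:M.
Proof.
split => [XX k|XX].
  by rewrite -dft_ttr -dft_tprod XX dft_tid.
by apply: dft_inj => k; rewrite dft_tprod dft_ttr XX dft_tid.
Qed.

(** An explicit formula for the Q factor, to replace the choice made by [qf]. *)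
Definition tgs n p l (A : tensor R n p l) : tensor R n p l :=
  idft (fun k => gs (dft A k)).

End Fourier.

(** * Elementary functions are smooth *)

Section ElementaryFunctions.
Context {R : realType}.

Section Elem.
Context {V : normedModType R}.

(** The side conditions are imposed on [U] only: Gram-Schmidt is a total function with junk values
    at rank-deficient matrices, and regularity is claimed only where the inverses and roots make
    sense. *)
Inductive elem (U : set V) : (V -> R) -> Prop :=
| elem_cst (c : R) : elem U (fun=> c)
| elem_lin (f : V -> R) : scalar f -> continuous f -> elem U f
| elem_add (f g : V -> R) : elem U f -> elem U g -> elem U (fun x => f x + g x)
| elem_mul (f g : V -> R) : elem U f -> elem U g -> elem U (fun x => f x * g x)
| elem_inv (f : V -> R) : elem U f -> (forall x, U x -> f x != 0) ->
    elem U (fun x => (f x)^-1)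
| elem_sqrt (f : V -> R) : elem U f -> (forall x, U x -> 0 < f x) ->
    elem U (fun x => Num.sqrt (f x)).

Lemma elem_ext (U : set V) (f g : V -> R) : f =1 g -> elem U f -> elem U g.
Proof. by move=> /funext ->. Qed.

Lemma diff_scalar (f : V -> R) x : scalar f -> continuous f ->
  differentiable f x /\ 'd f x = f :> (V -> R).
Proof.
move=> flin fcont.
pose fM := GRing.isLinear.Build _ _ _ _ f flin.
pose fL : {linear V -> R^o} := HB.pack f fM.
split; first exact: (@linear_differentiable _ _ _ fL).
exact: (@diff_lin _ _ _ fL).
Qed.

Lemma elem_differentiable (U : set V) f x : elem U f -> U x -> differentiable f x.
Proof.
move=> + Ux; elim => {f} [c|f flin fcont|f g _ df _ dg|f g _ df _ dg|f _ df f0|f _ df f0].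
- exact: differentiable_cst.
- by have [] := diff_scalar x flin fcont.
- exact: differentiableD.
- exact: differentiableM.
- by apply: differentiableV => //; exact: f0.
- apply: (@differentiable_comp _ _ _ _ f (@Num.sqrt R)) => //.
  by apply/derivable1_diffP; have [] := is_derive1_sqrt (f0 _ Ux).
Qed.

(** The rules of calculus stay inside the class. The derivative of a root has the denominator
    [2 * Num.sqrt (f x)], nonzero on [U] by positivity. *)
Lemma elem_derive (U : set V) f v : elem U f ->
  exists g, elem U g /\ forall x, U x -> 'D_v f x = g x.
Proof.
elim => {f} [c|f flin fcont|f g ef [f' [ef' f'E]] eg [g' [eg' g'E]]
  |f g ef [f' [ef' f'E]] eg [g' [eg' g'E]]|f ef [f' [ef' f'E]] f0|f ef [f' [ef' f'E]] f0].
- by exists (fun=> 0); split; [exact: elem_cst|move=> x _; exact: derive_cst].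
- exists (fun=> f v); split; first exact: elem_cst.
  by move=> x _; have [df fE] := diff_scalar x flin fcont; rewrite deriveE// fE.
- exists (fun x => f' x + g' x); split; first exact: elem_add.
  by move=> x Ux; rewrite deriveD ?f'E ?g'E//; apply/diff_derivable/elem_differentiable; eauto.
- exists (fun x => f x * g' x + g x * f' x); split.
    by apply: elem_add; exact: elem_mul.
  by move=> x Ux; rewrite deriveM ?f'E ?g'E//; apply/diff_derivable/elem_differentiable; eauto.
(* The opposite is written as a product with -1, as [elem] has no constructor for it. *)
- exists (fun x => -1 * ((f x)^-1 * (f x)^-1) * f' x); split.
    apply: elem_mul => //; apply: elem_mul; first exact: elem_cst.
    by apply: elem_mul; exact: elem_inv.
  move=> x Ux; rewrite deriveV ?f'E ?f0//.
    by rewrite mulN1r -invfM -expr2.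
  by apply/diff_derivable/elem_differentiable; eauto.
- exists (fun x => f' x * (2 * Num.sqrt (f x))^-1); split.
    apply: elem_mul => //; apply: elem_inv.
      by apply: elem_mul; [exact: elem_cst|exact: elem_sqrt].
    by move=> x Ux; rewrite mulf_neq0// gt_eqF// sqrtr_gt0 f0.
  move=> x Ux.
  have dsqrt : derivable (@Num.sqrt R) (f x) 1.
    by have [] := is_derive1_sqrt (f0 _ Ux).
  have df := elem_differentiable ef Ux.
  rewrite deriveE; last first.
    by apply: (@differentiable_comp _ _ _ _ f (@Num.sqrt R)) => //; exact/derivable1_diffP.
  rewrite (@diff_comp _ _ _ _ f (@Num.sqrt R))//; last exact/derivable1_diffP.
  by rewrite /= deriv1E// derive1E derive_sqrt ?f0// -f'E// deriveE.
Qed.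

(** On an open set, equality on [U] is equality near each of its points, which is all that limits
    and derivatives see. It is needed because [elem_derive] identifies derivatives on [U] only. *)
Lemma Ck_on_ext (W : normedModType R) k (U : set V) (f g : V -> W) : open U ->
  (forall x, U x -> f x = g x) -> Ck_on k U f -> Ck_on k U g.
Proof.
move=> oU.
have nearU (h h' : V -> W) x : (forall x, U x -> h x = h' x) -> U x ->
    \near x, h x = h' x.
  by move=> hh' Ux; apply: filterS (open_nbhs_nbhs (conj oU Ux)) => y; exact: hh'.
have near_continuous (h h' : V -> W) x : (\near x, h x = h' x) ->
    {for x, continuous h} -> {for x, continuous h'}.
  move=> hh' hc; suff : h' y @[y --> x] --> h x by rewrite (nbhs_singleton hh').
  have {}hc : h y @[y --> x] --> h x by [].
  by apply: cvg_trans hc; exact: near_eq_cvg.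
elim: k f g => [|k IHk] f g fg.
  move=> [fc _]; split => // x Ux. exact: (near_continuous _ _ _ (nearU _ _ _ fg Ux) (fc _ Ux)).
move=> [fc fd].
split=> [x Ux|v]; first exact: (near_continuous _ _ _ (nearU _ _ _ fg Ux) (fc _ Ux)).
have [dv Dv] := fd v; split=> [x Ux|].
  exact: (near_eq_derivable (nearU _ _ _ fg Ux) (dv _ Ux)).
by apply: IHk Dv => x Ux; exact/near_eq_derive/nearU.
Qed.

Lemma mx_continuous m n (F : V -> 'M[R]_(m, n)) x :
  (forall i j, {for x, continuous (fun y => F y i j)}) -> {for x, continuous F}.
Proof.
move=> Fc; apply/cvgrPdist_le => e e0; near=> y.
rewrite /Num.Def.normr/= mx_normrE (bigmax_le _ (ltW e0))//= => i _.
rewrite !mxE/=; move: i; near: y; apply: filter_forall => /= i.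
exact: ((cvgrPdist_le _ _).1 (Fc i.1 i.2)).
Unshelve. all: by end_near. Qed.

(** Induction on the order, for all [F] at once: the entries of a directional derivative agree on
    [U] with functions of the class again. *)
Lemma smooth_on_elem m n (U : set V) (F : V -> 'M[R]_(m, n)) : open U ->
  (forall i j, elem U (fun x => F x i j)) -> smooth_on U F.
Proof.
move=> oU eF k; elim: k F eF => [|k IHk] F eF.
  split => // x Ux; apply: mx_continuous => i j.
  exact/differentiable_continuous/(elem_differentiable (eF i j)).
have dF x v : U x -> derivable F x v.
  move=> Ux; apply/derivable_mxP => i j.
  exact/diff_derivable/(elem_differentiable (eF i j)).
split=> [x Ux|v].
  apply: mx_continuous => i j.
  exact/differentiable_continuous/(elem_differentiable (eF i j)).
split=> [x Ux|]; first exact: dF.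
pose G i j := sval (cid (elem_derive v (eF i j))).
have GP i j := svalP (cid (elem_derive v (eF i j))).
apply: (@Ck_on_ext _ _ _ (fun x => \matrix_(i, j) G i j x)) => //.
  move=> x Ux; rewrite derive_mx; last exact: dF.
  by apply/matrixP => i j; rewrite !mxE; have [_ ->] := GP i j.
apply: IHk => i j.
by apply: (@elem_ext _ (G i j)) => [x|]; [rewrite mxE|have [] := GP i j].
Qed.

End Elem.
End ElementaryFunctions.

(** * Elementary functions with complex and matrix values *)

Section ComplexElementary.
Context {R : realType} {V : normedModType R} (U : set V).
Local Notation C := R[i].
Local Open Scope complex_scope.
Local Notation re := (@complex.Re R).
Local Notation im := (@complex.Im R).

Definition celem (f : V -> C) :=
  elem U (fun x => re (f x)) /\ elem U (fun x => im (f x)).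

Lemma celem_ext (f g : V -> C) : f =1 g -> celem f -> celem g.
Proof. by move=> /funext ->. Qed.

Lemma celem_cst (c : C) : celem (fun=> c).
Proof. by split; exact: elem_cst. Qed.

Lemma celem_real (f : V -> R) : elem U f -> celem (fun x => (f x)%:C).
Proof. by move=> ef; split; [exact: ef|exact: elem_cst]. Qed.

Lemma celem_add (f g : V -> C) : celem f -> celem g -> celem (fun x => f x + g x).
Proof.
move=> [fr fi] [gr gi]; split.
  by apply: (elem_ext _ (elem_add fr gr)) => x /=; case: (f x) (g x) => ? ? [].
by apply: (elem_ext _ (elem_add fi gi)) => x /=; case: (f x) (g x) => ? ? [].
Qed.

Lemma celem_mul (f g : V -> C) : celem f -> celem g -> celem (fun x => f x * g x).
Proof.
move=> [fr fi] [gr gi]; split.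
  apply: (elem_ext _ (elem_add (elem_mul fr gr)
    (elem_mul (elem_cst U (-1)) (elem_mul fi gi)))) => x /=.
  by case: (f x) (g x) => ? ? [? ?] /=; rewrite mulN1r.
apply: (elem_ext _ (elem_add (elem_mul fr gi) (elem_mul fi gr))) => x /=.
by case: (f x) (g x) => ? ? [? ?].
Qed.

Lemma celem_conj (f : V -> C) : celem f -> celem (fun x => conjc (f x)).
Proof.
move=> [fr fi]; split.
  by apply: (elem_ext _ fr) => x /=; case: (f x).
apply: (elem_ext _ (elem_mul (elem_cst U (-1)) fi)) => x /=.
by case: (f x) => ? ? /=; rewrite mulN1r.
Qed.

Lemma celem_sum (I : Type) (r : seq I) (P : pred I) (F : I -> V -> C) :
  (forall i, celem (F i)) -> celem (fun x => \sum_(i <- r | P i) F i x).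
Proof.
move=> eF; elim: r => [|i r IHr].
  by apply: (celem_ext _ (celem_cst 0)) => x; rewrite big_nil.
case Pi : (P i).
  by apply: (celem_ext _ (celem_add (eF i) IHr)) => x; rewrite big_cons Pi.
by apply: (celem_ext _ IHr) => x; rewrite big_cons Pi.
Qed.

Lemma celem_prod (I : Type) (r : seq I) (P : pred I) (F : I -> V -> C) :
  (forall i, celem (F i)) -> celem (fun x => \prod_(i <- r | P i) F i x).
Proof.
move=> eF; elim: r => [|i r IHr].
  by apply: (celem_ext _ (celem_cst 1)) => x; rewrite big_nil.
case Pi : (P i).
  by apply: (celem_ext _ (celem_mul (eF i) IHr)) => x; rewrite big_cons Pi.
by apply: (celem_ext _ IHr) => x; rewrite big_cons Pi.
Qed.

Lemma elem_sum (I : Type) (r : seq I) (F : I -> V -> R) :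
  (forall i, elem U (F i)) -> elem U (fun x => \sum_(i <- r) F i x).
Proof.
move=> eF; elim: r => [|i r IHr].
  by apply: (elem_ext _ (elem_cst U 0)) => x; rewrite big_nil.
by apply: (elem_ext _ (elem_add (eF i) IHr)) => x; rewrite big_cons.
Qed.

Definition melem m n (F : V -> 'M[C]_(m, n)) := forall i j, celem (fun x => F x i j).

Lemma melem_mul m n p (F : V -> 'M[C]_(m, n)) (G : V -> 'M[C]_(n, p)) :
  melem F -> melem G -> melem (fun x => F x *m G x).
Proof.
move=> eF eG i j; have := celem_sum (index_enum _) xpredT (fun k => celem_mul (eF i k) (eG k j)).
by apply: celem_ext => x; rewrite mxE.
Qed.

Lemma melem_ctr m n (F : V -> 'M[C]_(m, n)) : melem F -> melem (fun x => ctr (F x)).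
Proof.
by move=> eF i j; apply: (celem_ext _ (celem_conj (eF j i))) => x; rewrite !mxE.
Qed.

Lemma melem_sub m n (F G : V -> 'M[C]_(m, n)) :
  melem F -> melem G -> melem (fun x => F x - G x).
Proof.
move=> eF eG i j.
apply: (celem_ext _ (celem_add (eF i j) (celem_mul (celem_cst (-1)) (eG i j)))) => x.
by rewrite !mxE mulN1r.
Qed.

Lemma melem_row_mx m n p (F : V -> 'M[C]_(m, n)) (G : V -> 'M[C]_(m, p)) :
  melem F -> melem G -> melem (fun x => row_mx (F x) (G x)).
Proof.
move=> eF eG i j; case: (split_ordP j) => k ->.
  by apply: (celem_ext _ (eF i k)) => x; rewrite row_mxEl.
by apply: (celem_ext _ (eG i k)) => x; rewrite row_mxEr.
Qed.

Lemma melem_lsubmx m n p (F : V -> 'M[C]_(m, n + p)) :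
  melem F -> melem (fun x => lsubmx (F x)).
Proof. by move=> eF i j; apply: (celem_ext _ (eF i (lshift p j))) => x; rewrite mxE. Qed.

Lemma melem_rsubmx m n p (F : V -> 'M[C]_(m, n + p)) :
  melem F -> melem (fun x => rsubmx (F x)).
Proof. by move=> eF i j; apply: (celem_ext _ (eF i (rshift n j))) => x; rewrite mxE. Qed.

Lemma celem_det n (F : V -> 'M[C]_n) : melem F -> celem (fun x => \det (F x)).
Proof.
move=> eF; apply: (celem_sum (index_enum _) xpredT) => s.
by apply: celem_mul; [exact: celem_cst|apply: celem_prod => i; exact: eF].
Qed.

Lemma melem_normalize m (F : V -> 'cV[C]_m) : melem F ->
  (forall x, U x -> F x != 0) -> melem (fun x => normalize (F x)).
Proof.
move=> eF F0 i j.
have sF0 x : U x -> 0 < sqn (F x).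
  move=> /F0 Fx0; rewrite lt_def sqn_ge0 andbT.
  by apply: contra_neq Fx0; exact: sqn_eq0.
have sF : elem U (fun x => sqn (F x)).
  apply: elem_sum => k; have [Fr Fi] := eF k 0.
  apply: (elem_ext _ (elem_add (elem_mul Fr Fr) (elem_mul Fi Fi))) => x.
  by rewrite !expr2.
have sV : elem U (fun x => (Num.sqrt (sqn (F x)))^-1).
  apply: elem_inv; first exact: elem_sqrt.
  by move=> x Ux; rewrite gt_eqF// sqrtr_gt0 sF0.
by apply: (celem_ext _ (celem_mul (celem_real sV) (eF i j))) => x; rewrite mxE.
Qed.

(** Injectivity makes the first column nonzero, so its normalization is elementary, and it passes to
    the deflated block for the induction. *)
Lemma melem_gs m n (F : V -> 'M[C]_(m, n)) : melem F ->
  (forall x, U x -> mxinj (F x)) -> melem (fun x => gs (F x)).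
Proof.
elim: n F => [//|n IHn] F eF Finj.
rewrite -[n.+1]/(1 + n)%N in F eF Finj *.
have eq : melem (fun x => normalize (lsubmx (F x))).
  apply: melem_normalize; first exact: melem_lsubmx.
  by move=> x /Finj; exact: mxinj_lsubmx_neq0.
apply: (melem_row_mx eq); apply: IHn; last by move=> x /Finj; exact: mxinj_deflate.
apply: melem_sub; first exact: melem_rsubmx.
apply: (melem_mul eq); apply: melem_mul; first exact: melem_ctr.
exact: melem_rsubmx.
Qed.

Lemma melem_dft n p l (A : V -> tensor R n p l) (k : 'I_l) :
  (forall r j, elem U (fun x => A x r j)) -> melem (fun x => dft (A x) k).
Proof.
move=> eA i j.
have := celem_sum (index_enum _) xpredT (fun m : 'I_l =>
  celem_mul (celem_cst (omega R l ^+ (k * m))) (celem_real (eA (mxvec_index m i) j))).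
apply: celem_ext => x; rewrite /dft summxE; apply: eq_bigr => m _.
by rewrite !mxE.
Qed.

Lemma elem_tgs n p l (A : V -> tensor R n p l) :
  (forall r j, elem U (fun x => A x r j)) -> (forall x, U x -> in_Linv_Cstar (A x)) ->
  forall r j, elem U (fun x => tgs (A x) r j).
Proof.
move=> eA Ainj r j; have eG k : melem (fun x => gs (dft (A x) k)).
  by apply: melem_gs => [|x /Ainj/(_ k)/mxinj_rank//]; exact: melem_dft.
have [+ _] := celem_mul (celem_cst (l%:R^-1)) (celem_sum (index_enum _) xpredT
  (fun k : 'I_l => celem_mul (celem_cst (conjc (omega R l ^+ (k * (blk_idx r).1))))
    (eG k (blk_idx r).2 j))).
apply: elem_ext => x; rewrite /tgs /idft !mxE summxE; congr (re (_ * _)).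
by apply: eq_bigr => k _; rewrite mxE.
Qed.

End ComplexElementary.

(** * The t-QR decomposition and its derivative *)

Section TensorQR.
Context {R : realType}.
Local Notation C := R[i].
Local Open Scope complex_scope.
Local Notation cj := (@conjc R).

Lemma ctr_conj m n (M : 'M[C]_(m, n)) : ctr (map_mx cj M) = map_mx cj (ctr M).
Proof. by apply/matrixP => i j; rewrite !mxE. Qed.

(** Conjugating a QR decomposition gives one of the conjugate matrix, since the positive real
    diagonal is fixed; [gs_uniq] concludes. *)
Lemma gs_conj n p (M : 'M[C]_(n, p)) : mxinj M -> gs (map_mx cj M) = map_mx cj (gs M).
Proof.
move=> /gs_QR[QQ [T [[Tlow Tdiag] ME]]]; apply/esym.
apply: (gs_uniq (T := map_mx cj T)).
- by rewrite ctr_conj -(map_mxM cj) QQ (map_mx1 cj).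
- split=> [i j ji|i]; first by rewrite mxE Tlow ?conjc0.
  by have [r [r0 rE]] := Tdiag i; exists r; rewrite mxE rE conjc_real.
- by rewrite [in LHS]ME (map_mxM cj).
Qed.

Lemma dft_tgs n p l (A : tensor R n p l) k :
  in_Linv_Cstar A -> dft (tgs A) k = gs (dft A k).
Proof.
move=> Ainj; rewrite /tgs idftK// => {}k.
by rewrite dft_conj gs_conj//; apply/mxinj_rank.
Qed.

Lemma tQR_tgs n p l (A Q : tensor R n p l) Rt : tQR A Q Rt -> Q = tgs A.
Proof.
move=> [/StiefelP QQ [Ru AE]]; apply: dft_inj => k; rewrite /tgs.
have GE m : gs (dft A m) = dft Q m.
  by apply/esym/(gs_uniq (T := dft Rt m)) => //; rewrite AE dft_tprod.
(* The symmetry required by [idftK] holds because these slices are those of the real tensor [Q]. *)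
by rewrite idftK => [|m]; rewrite !GE// dft_conj.
Qed.

Lemma tgs_tQR n p l (A : tensor R n p l) :
  in_Linv_Cstar A -> exists Rt, tQR A (tgs A) Rt.
Proof.
move=> Ainj; have Aqr k : mxinj (dft A k) by apply/mxinj_rank.
(* The triangular factor is recovered slicewise as Q^H A, a formula whose conjugation symmetry can
   be checked directly. *)
exists (idft (fun k => ctr (gs (dft A k)) *m dft A k)).
have RE k : dft (idft (fun k => ctr (gs (dft A k)) *m dft A k)) k =
    ctr (gs (dft A k)) *m dft A k.
  by apply: idftK => m; rewrite dft_conj gs_conj// ctr_conj (map_mxM cj).
split; last split.
- apply/StiefelP => k; rewrite dft_tgs//; by have [] := gs_QR (Aqr k).
- move=> k; have [QQ [T [Tu AE]]] := gs_QR (Aqr k).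
  suff -> : dft (idft (fun k => ctr (gs (dft A k)) *m dft A k)) k = T by [].
  by rewrite RE {2}AE mulmxA QQ mul1mx.
- apply: dft_inj => k; rewrite dft_tprod RE dft_tgs//.
  have [QQ [T [Tu AE]]] := gs_QR (Aqr k).
  by rewrite (_ : ctr _ *m dft A k = T) // {2}AE mulmxA QQ mul1mx.
Qed.

Lemma qf_tgs n p l (A : tensor R n p l) : in_Linv_Cstar A -> qf A = tgs A.
Proof.
move=> /tgs_tQR Aqr; apply: xget_unique => // Q [Rt]; exact: tQR_tgs.
Qed.

Lemma Stiefel_Cstar n p l (X : tensor R n p l) : Stiefel R n p l X -> in_Linv_Cstar X.
Proof.
move=> /StiefelP XX k; apply/mxinj_rank => u Xu0.
by rewrite -[u]mul1mx -(XX k) -mulmxA Xu0 mulmx0.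
Qed.

Lemma qf_Stiefel n p l (X : tensor R n p l) : Stiefel R n p l X -> qf X = X.
Proof.
move=> StX; rewrite qf_tgs; last exact: Stiefel_Cstar.
apply/esym/(@tQR_tgs _ _ _ _ _ (tid R p l)); split=> //; split.
  move=> k; rewrite dft_tid; split=> [i j|i].
    by rewrite ltnNge mxE; case: eqP => // ->; rewrite leqnn.
  by exists 1; rewrite mxE eqxx.
by apply: dft_inj => k; rewrite dft_tprod dft_tid mulmx1.
Qed.

End TensorQR.

(** * Tangent vectors, openness of the full-rank domain, and the derivative of [qf] *)

Section Derivatives.
Context {R : realType}.

Lemma is_derive_mxP (V : normedModType R) m n (F : V -> 'M[R]_(m, n)) x v D :
  is_derive x v F D <-> forall i j, is_derive x v (fun y => F y i j) (D i j).
Proof.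
split => [[dF <-] i j|dF].
  apply: DeriveDef; first exact: (derivable_mxP _ _ _).1.
  by rewrite derive_mx// mxE.
have dF' : derivable F x v by apply/derivable_mxP => i j; have [] := dF i j.
apply: DeriveDef => //; rewrite derive_mx//; apply/matrixP => i j; rewrite mxE.
by have [] := dF i j.
Qed.

Lemma is_derive_comp_diff (V : normedModType R) (f : V -> R) (c : R -> V) (t : R) v :
  is_derive t 1 c v -> differentiable f (c t) -> is_derive t (1 : R) (f \o c) ('d f (c t) v).
Proof.
move=> [dc <-] df; have dc' := (derivable1_diffP _ _).1 dc.
have dfc : differentiable (f \o c) t by exact: differentiable_comp.
apply: DeriveDef; first exact: diff_derivable.
by rewrite deriveE// diff_comp//= deriveE.
Qed.

Lemma elem_coord (n p : nat) (U : set 'M[R]_(n, p)) i j : elem U (fun A => A i j).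
Proof.
apply: elem_lin; last exact: coord_continuous.
by move=> a A B; rewrite !mxE.
Qed.

(** As [elem] has no substitution rule, the coordinates of a sum enter as linear forms on the
    product space. *)
Lemma elem_coord_add (n p : nat) (U : set ('M[R]_(n, p) * 'M[R]_(n, p))) i j :
  elem U (fun AB => (AB.1 + AB.2) i j).
Proof.
apply: elem_lin => [a [A B] [A' B']|].
  by rewrite !mxE /=; ring.
move=> x; pose g (AB : 'M[R]_(n, p) * 'M[R]_(n, p)) : 'M[R]_(n, p) := AB.1 + AB.2.
have gc : {for x, continuous g} by exact: add_continuous.
exact: (continuous_comp gc (@coord_continuous _ _ _ i j _)).
Qed.

Lemma open_Linv_Cstar n p l : open [set A : tensor R n p l | in_Linv_Cstar A].
Proof.
rewrite openE => A Ainj.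
have near_k (k : 'I_l) : nbhs A [set B : tensor R n p l | mxinj (dft B k)].
  pose d (B : tensor R n p l) := \det (ctr (dft B k) *m dft B k).
  have [dr di] : celem setT d.
    apply: celem_det; apply: melem_mul; first apply: melem_ctr.
      by apply: melem_dft => r j; exact: elem_coord.
    by apply: melem_dft => r j; exact: elem_coord.
  (* The squared modulus of the Gram determinant: a real function with the same zeros, continuous
     because it is elementary on the whole space. *)
  pose f B := complex.Re (d B) * complex.Re (d B) + complex.Im (d B) * complex.Im (d B).
  have f0 B : (f B != 0) = (d B != 0).
    rewrite /f -!expr2 paddr_eq0 ?sqr_ge0// !sqrf_eq0.
    by case: (d B) => x y; rewrite eq_complex.
  have fc : {for A, continuous f}.
    apply/differentiable_continuous/(@elem_differentiable _ _ setT) => //.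
    by apply: elem_add; exact: elem_mul.
  have fA : f A != 0 by rewrite f0; apply/mxinj_det/mxinj_rank/Ainj.
  apply: (filterS _ (cvgr_neq0 _ fc fA)) => B; rewrite /= f0 => dB.
  exact/mxinj_det.
apply: (filterS _ (@filter_forall _ _ _ (nbhs A) _ near_k)) => B Binj k.
exact/mxinj_rank/Binj.
Qed.

Lemma bcirc_ttrE n p l (A : tensor R n p l) r s :
  bcirc (ttr A) r s = A (mxvec_index
    (ord_neg (ord_mod (blk_idx r).1 ((blk_idx r).1 + l - (blk_idx s).1)))
    (blk_idx s).2) (blk_idx r).2.
Proof. by rewrite !mxE blk_idxK. Qed.

Lemma tangent_Stiefel n p l (X V : tensor R n p l) :
  tangent_space (Stiefel R n p l) X V -> tprod (ttr X) V + tprod (ttr V) X = 0.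
Proof.
move=> [c [Mc [c0 cV]]]; apply/matrixP => r j.
have dc := (is_derive_mxP _ _ _ _).1 cV.
pose h s (t : R) := bcirc (ttr (c t)) r s * c t s j.
have dh s : is_derive (0 : R) 1 (h s)
    (bcirc (ttr X) r s *: V s j + X s j *: bcirc (ttr V) r s).
  rewrite /h; under eq_fun do rewrite bcirc_ttrE.
  rewrite !bcirc_ttrE -c0; exact: is_deriveM.
have dsum := is_derive_sum dh.
(* This sum is entry [(r, j)] of the product of [ttr (c t)] and [c t], which is constant while the
   curve stays in the Stiefel manifold. *)
have [_ E0] : is_derive (0 : R) 1 (\sum_s h s) 0.
  apply: (@near_eq_is_derive _ _ _ (cst (tid R p l r j))).
  near=> t; rewrite fct_sumE; have /matrixP/(_ r j) : tprod (ttr (c t)) (c t) = tid R p l.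
    by near: t.
  by rewrite mxE => <-.
have [_] := dsum; rewrite E0 big_split => E.
by rewrite [RHS]mxE E mxE mxE [in X in _ + X]mxE; congr (_ + _); apply: eq_bigr => s _; rewrite mulrC.
Unshelve. all: by end_near. Qed.

Lemma tangent_Cstar n p l (X V : tensor R n p l) :
  Stiefel R n p l X -> tangent_space (Stiefel R n p l) X V -> in_Linv_Cstar (X + V).
Proof.
move=> /StiefelP XX /tangent_Stiefel XV k; apply/mxinj_rank => u XVu0.
have XVk : ctr (dft X k) *m dft V k + ctr (dft V k) *m dft X k = 0.
  rewrite -!dft_ttr -!dft_tprod -dftD XV /dft big1// => j _.
  by apply/matrixP => a b; rewrite !mxE mulr0.
move: XVu0; rewrite dftD; set Xk := dft X k; set Vk := dft V k => XVu0.
(* The left side is the squared norm of [(Xk + Vk) *m u]: the cross terms cancel by [XVk], and the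
   Gram matrix of [Xk] is the identity. *)
have E : sqn u + sqn (Vk *m u) = 0.
  apply: complexI; rewrite rmorphD rmorph0 /=.
  have /matrixP/(_ 0 0) : ctr u *m u + ctr (Vk *m u) *m (Vk *m u) = 0.
    have -> : ctr u *m u + ctr (Vk *m u) *m (Vk *m u) =
        ctr ((Xk + Vk) *m u) *m ((Xk + Vk) *m u).
      rewrite !ctr_mul ctrD -!mulmxA -mulmxDr; congr (_ *m _).
      rewrite -[in LHS](mul1mx u) !mulmxA mulmx1 -mulmxDl; congr (_ *m _).
      by rewrite mulmxDl !mulmxDr XX -addrA [X in _ = _ + X]addrA XVk add0r.
    by rewrite XVu0 mulmx0.
  by rewrite !ctr_mul_col !mxE eqxx.
by apply: sqn_eq0; move: E (sqn_ge0 u) (sqn_ge0 (Vk *m u)); lra.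
Qed.

Lemma is_derive_qf n p l (X V : tensor R n p l) :
  Stiefel R n p l X -> tangent_space (Stiefel R n p l) X V ->
  is_derive (0 : R) 1 (fun t : R => qf (X + t *: V)) V.
Proof.
move=> StX [c [Mc [c0 cV]]].
pose U := [set A : tensor R n p l | in_Linv_Cstar A].
have UX : U X by exact: Stiefel_Cstar.
have dtgs r j : differentiable (fun A : tensor R n p l => tgs A r j) X.
  by apply: (@elem_differentiable _ _ U) => //; apply: elem_tgs => // *; exact: elem_coord.
have dE r j : 'd (fun A : tensor R n p l => tgs A r j) X V = V r j.
  have dcomp : is_derive (0 : R) 1 ((fun A => tgs A r j) \o c)
      ('d (fun A : tensor R n p l => tgs A r j) X V).
    by have := is_derive_comp_diff cV; rewrite c0; exact.
  have [_ <-] := dcomp; have [_ <-] := (is_derive_mxP _ _ _ _).1 cV r j.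
  (* Near 0 the curve consists of Stiefel points, which [tgs] fixes. *)
  apply: near_eq_derive; near=> t => /=.
  have Mct : Stiefel R n p l (c t) by near: t.
  by rewrite -qf_tgs ?qf_Stiefel//; exact: Stiefel_Cstar.
have dline : is_derive (0 : R) 1 (fun t : R => X + t *: V) V.
  apply/is_derive_mxP => i j.
  rewrite (_ : (fun t => _) = cst (X i j) + id * cst (V i j)); last first.
    by apply/funext => t; rewrite !mxE.
  by apply: is_derive_eq; rewrite scaler0 !add0r [_ *: _]mulr1.
(* Openness of the full-rank domain keeps the line inside it for small [t], so [qf] may be replaced
   by [tgs]. *)
apply: (@near_eq_is_derive _ _ _ (fun t : R => tgs (X + t *: V))).
  near=> t; apply/esym/qf_tgs; near: t.
  have lc : {for (0 : R), continuous (fun t : R => X + t *: V)}.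
    by apply/differentiable_continuous/derivable1_diffP; have [] := dline.
  apply: (lc U); rewrite scale0r addr0; exact: (open_nbhs_nbhs (conj (@open_Linv_Cstar n p l) UX)).
apply/is_derive_mxP => r j; rewrite -dE.
by have := is_derive_comp_diff dline; rewrite scale0r addr0; exact.
Unshelve. all: by end_near. Qed.

End Derivatives.

Theorem mainTheorem5 (R : realType) (n p l : nat) (hnp : (p <= n)%N) :
  (forall (X V : tensor R n p l),
     Stiefel R n p l X -> tangent_space (Stiefel R n p l) X V ->
     in_Linv_Cstar (X + V)) /\
  is_retraction (Stiefel R n p l)
    (fun XV : tensor R n p l * tensor R n p l => qf (XV.1 + XV.2)).
Proof.
split; first by move=> X V; exact: tangent_Cstar.
split; last split; last split.
- move=> [X V] [/= StX TV].
  (* One open set serves at every point of the tangent bundle: the pairs whose sum has full-rank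
     slices. *)
  exists [set AB : tensor R n p l * tensor R n p l | in_Linv_Cstar (AB.1 + AB.2)].
  have oU : open [set AB : tensor R n p l * tensor R n p l | in_Linv_Cstar (AB.1 + AB.2)].
    pose g (AB : tensor R n p l * tensor R n p l) : tensor R n p l := AB.1 + AB.2.
    apply: (@open_comp _ _ g _ _ (@open_Linv_Cstar R n p l)).
    by move=> x _; exact: add_continuous.
  split => //; split; first exact: tangent_Cstar.
  (* The smooth extension is the Gram-Schmidt formula, equal to [qf] on all of this open set. *)
  exists (fun AB => tgs (AB.1 + AB.2)); split; last by move=> AB _ /= /qf_tgs.
  apply: smooth_on_elem => // r j.
  by apply: elem_tgs => // *; exact: elem_coord_add.
- move=> X V StX TV /=; have XV := tangent_Cstar StX TV.
  by rewrite qf_tgs//; have [Rt []] := tgs_tQR XV.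
- by move=> X StX /=; rewrite addr0 qf_Stiefel.
- by move=> X V StX TV; exact: is_derive_qf.
Qed.
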